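(* Let $\alpha>0$ be a constant and let $n\ge2$. The function $$p^\alpha_{\mathbb{R}^n\setminus\{0\}}(x,y)=\frac{|x-y|}{\sqrt{|x-y|^2+\alpha|x|\,|y|}},\quad x,y\in\mathbb{R}^n\setminus\{0\},$$ is a metric on $\mathbb{R}^n\setminus\{0\}$ if and only if $\alpha\le12$.
   Context: $|\cdot|$ denotes the Euclidean norm on $\mathbb{R}^n$. *)

(* Defs.v *)
From mathcomp Require Import all_boot all_order all_algebra.
From mathcomp Require Import all_classical all_reals.
Import Order.TTheory GRing.Theory Num.Theory.

Set Implicit Arguments.
Unset Strict Implicit.
Unset Printing Implicit Defensive.

Local Open Scope classical_set_scope.
Local Open Scope ring_scope.

(* The norm that MathComp-Analysis puts on 'rV[R]_n is the sup norm, so the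
   Euclidean norm is defined here. *)
Definition enorm (R : realType) (n : nat) (x : 'rV[R]_n) : R :=
  Num.sqrt (\sum_(i < n) x 0 i ^+ 2).

(* MathComp-Analysis only has metric spaces as a structure on a type
   (metricType); this is the corresponding property of a given function [d],
   whose values outside [A] are irrelevant. *)
Record is_metric_on (R : realType) (T : Type) (A : set T) (d : T -> T -> R)
    : Prop := IsMetricOn {
  metric_on_ge0 : forall x y, A x -> A y -> 0 <= d x y;
  metric_on_eq0 : forall x y, A x -> A y -> (d x y = 0 <-> x = y);
  metric_on_sym : forall x y, A x -> A y -> d x y = d y x;
  metric_on_triangle : forall x y z, A x -> A y -> A z ->
    d x z <= d x y + d y z
}.

Definition punctured_space (R : realType) (n : nat) : set 'rV[R]_n :=
  [set x | x != 0].

Definition point_pair (R : realType) (n : nat) (alpha : R)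
    (x y : 'rV[R]_n) : R :=
  enorm (x - y) /
  Num.sqrt (enorm (x - y) ^+ 2 + alpha * enorm x * enorm y).

(* Main.v *)
Require Import Defs.
From mathcomp Require Import all_boot all_order all_algebra.
From mathcomp Require Import all_classical all_reals.
From mathcomp Require Import ring lra.
Import Order.TTheory GRing.Theory Num.Theory.
Set Implicit Arguments.
Unset Strict Implicit.
Local Open Scope ring_scope.

(** Put [w = |x - y| / sqrt (|x| |y|)], so that the value at [(x, y)] is
    [w / sqrt (w^2 + alpha)].  Ptolemy's inequality for the four points
    [x, y, z, -y], together with [|x + y|^2 <= |x - y|^2 + 4 |x| |y|], says that
    [w = 2 sinh s] where [s] satisfies the triangle inequality, and
    [s |-> sinh s / sqrt (sinh^2 s + alpha / 4)] is subadditive when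
    [alpha <= 12].  Conversely, for [alpha > 12] this function is strictly
    convex near [0], and the triangle inequality fails for the collinear points
    [e, t e, t^2 e] with [t > 1] close to [1]. *)

(** * Euclidean inner product, Cauchy-Schwarz and Ptolemy's inequality *)

Section EuclideanNorm.
Variables (R : realType) (n : nat).
Implicit Types (x y z : 'rV[R]_n) (c : R).

Definition dot x y : R := \sum_(i < n) x 0 i * y 0 i.

Lemma dotC x y : dot x y = dot y x.
Proof. by apply: eq_bigr => i _; rewrite mulrC. Qed.

Lemma dotDl x y z : dot (x + y) z = dot x z + dot y z.
Proof. by rewrite -big_split; apply: eq_bigr => i _; rewrite !mxE mulrDl. Qed.

Lemma dotZl c x y : dot (c *: x) y = c * dot x y.
Proof. by rewrite mulr_sumr; apply: eq_bigr => i _; rewrite !mxE mulrA. Qed.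

Lemma dotNl x y : dot (- x) y = - dot x y.
Proof. by rewrite -scaleN1r dotZl mulN1r. Qed.

Lemma dotDr x y z : dot x (y + z) = dot x y + dot x z.
Proof. by rewrite dotC dotDl !(dotC x). Qed.

Lemma dotZr c x y : dot x (c *: y) = c * dot x y.
Proof. by rewrite dotC dotZl (dotC x). Qed.

Lemma dotNr x y : dot x (- y) = - dot x y.
Proof. by rewrite dotC dotNl (dotC x). Qed.

Definition dotE := (dotDl, dotDr, dotNl, dotNr, dotZl, dotZr).

Lemma dot_ge0 x : 0 <= dot x x.
Proof. by apply: sumr_ge0 => i _; rewrite -expr2 sqr_ge0. Qed.

Lemma enorm_ge0 x : 0 <= enorm x.
Proof. exact: sqrtr_ge0. Qed.

Lemma enorm_sqr x : enorm x ^+ 2 = dot x x.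
Proof. by rewrite sqr_sqrtr// sumr_ge0// => i _; rewrite sqr_ge0. Qed.

Lemma enorm_eq0 x : (enorm x == 0) = (x == 0).
Proof.
rewrite -sqrf_eq0 enorm_sqr; apply/eqP/eqP => [x0|->]; last first.
  by rewrite /dot big1// => i _; rewrite mxE mul0r.
apply/rowP => i; rewrite mxE; apply/eqP; rewrite -sqrf_eq0 expr2.
by move/psumr_eq0P: x0 => -> // j _; rewrite -expr2 sqr_ge0.
Qed.

Lemma enorm_gt0 x : (0 < enorm x) = (x != 0).
Proof. by rewrite lt0r enorm_ge0 andbT enorm_eq0. Qed.

Lemma enormZ c x : enorm (c *: x) = `|c| * enorm x.
Proof.
apply/eqP; rewrite -(@eqrXn2 _ 2)// ?mulr_ge0 ?enorm_ge0//.
by rewrite exprMn real_normK ?num_real// !enorm_sqr !dotE mulrA -expr2.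
Qed.

Lemma enormN x : enorm (- x) = enorm x.
Proof. by rewrite -scaleN1r enormZ normrN1 mul1r. Qed.

Lemma enormBC x y : enorm (x - y) = enorm (y - x).
Proof. by rewrite -enormN opprB. Qed.

(** Cauchy-Schwarz, from the nonnegative square of [dot y y] times the component of [x] orthogonal
    to [y]. *)
Lemma dot_le x y : dot x y <= enorm x * enorm y.
Proof.
have [->|y0] := eqVneq y 0.
  by rewrite -[0](scale0r y) dotZr mul0r mulr_ge0 ?enorm_ge0.
have y1 : 0 < dot y y by rewrite -enorm_sqr exprn_gt0// enorm_gt0.
apply: le_trans (ler_norm _) _.
rewrite -(@ler_pXn2r _ 2) ?nnegrE ?mulr_ge0 ?enorm_ge0//.
rewrite real_normK ?num_real// exprMn !enorm_sqr -(ler_pM2l y1) -subr_ge0.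
have := dot_ge0 (dot y y *: x - dot x y *: y).
by rewrite !dotE (dotC y x); congr (0 <= _); ring.
Qed.

Lemma enormD x y : enorm (x + y) <= enorm x + enorm y.
Proof.
rewrite -(@ler_pXn2r _ 2) ?nnegrE ?addr_ge0 ?enorm_ge0//.
rewrite sqrrD !enorm_sqr !dotE (dotC y x); have := dot_le x y; lra.
Qed.

(* Inversion [x |-> x / |x|^2] multiplies [|x - y|] by [1 / (|x| |y|)]; this is
   that identity with denominators cleared. *)
Lemma enorm_inversion x y :
  enorm (enorm y ^+ 2 *: x - enorm x ^+ 2 *: y)
    = enorm x * enorm y * enorm (x - y).
Proof.
apply/eqP; rewrite -(@eqrXn2 _ 2)// ?mulr_ge0 ?enorm_ge0//.
rewrite !exprMn !enorm_sqr !dotE (dotC y x); apply/eqP; ring.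
Qed.

(** Triangle inequality for the images of [x], [z], [y] under inversion, denominators cleared.
    Inversion is undefined at [0], so zero vectors are treated first. *)
Lemma ptolemy x y z :
  enorm z * enorm (x - y)
    <= enorm x * enorm (y - z) + enorm y * enorm (x - z).
Proof.
have enorm0 : enorm (0 : 'rV[R]_n) = 0 by apply/eqP; rewrite enorm_eq0.
have [->|] := eqVneq x 0.
  by rewrite !sub0r !enormN enorm0 mul0r add0r mulrC.
have [->|] := eqVneq y 0.
  by rewrite !subr0 sub0r enormN mulrC lerDl mulr_ge0 ?enorm_ge0.
have [->|] := eqVneq z 0.
  by rewrite enorm0 mul0r addr_ge0 ?mulr_ge0 ?enorm_ge0.
rewrite -!enorm_gt0 => z0 y0 x0.
have xyz0 : 0 < enorm x * enorm y * enorm z by rewrite !mulr_gt0.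
(* With [x' = x / |x|^2] and likewise for [y], [z], the two summands are [|x|^2 |y|^2 |z|^2] times
   [x' - z'] and [z' - y']. *)
have := enormD (enorm y ^+ 2 *: (enorm z ^+ 2 *: x - enorm x ^+ 2 *: z))
  (enorm x ^+ 2 *: (enorm z ^+ 2 *: - y - enorm (- y) ^+ 2 *: - z)).
have -> : enorm y ^+ 2 *: (enorm z ^+ 2 *: x - enorm x ^+ 2 *: z)
    + enorm x ^+ 2 *: (enorm z ^+ 2 *: - y - enorm (- y) ^+ 2 *: - z)
    = enorm z ^+ 2 *: (enorm y ^+ 2 *: x - enorm x ^+ 2 *: y).
  by apply/rowP => i; rewrite enormN !mxE; ring.
have -> : enorm z ^+ 2 *: - y - enorm (- y) ^+ 2 *: - z
    = - (enorm z ^+ 2 *: y - enorm y ^+ 2 *: z).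
  by rewrite enormN !scalerN opprB opprK addrC.
rewrite 3!enormZ enormN !enorm_inversion !ger0_norm ?sqr_ge0// => h.
by rewrite -(ler_pM2l xyz0); apply: le_trans (le_trans h _);
  rewrite le_eqVlt; apply/orP; left; apply/eqP; ring.
Qed.

(** Polarization, [|x + y|^2 = |x - y|^2 + 4 dot x y], followed by Cauchy-Schwarz. *)
Lemma enorm_add_le x y :
  enorm (x + y) <= Num.sqrt (enorm (x - y) ^+ 2 + 4 * (enorm x * enorm y)).
Proof.
rewrite -[leLHS]ger0_norm ?enorm_ge0// -sqrtr_sqr ler_wsqrtr//.
by rewrite !enorm_sqr !dotE (dotC y x); have := dot_le x y; lra.
Qed.

End EuclideanNorm.

(** * Real inequalities for the quotient [w / sqrt (w^2 + a)] *)

(* With [u = 2 sinh s], [v = 2 sinh t] the hypothesis reads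
   [w <= 2 sinh (s + t)]. *)
Lemma sinh_quotient_subadditive (R : realType) (a u v w : R) :
  0 < a -> a <= 12 -> 0 <= u -> 0 <= v -> 0 <= w ->
  2 * w <= u * Num.sqrt (v ^+ 2 + 4) + v * Num.sqrt (u ^+ 2 + 4) ->
  w / Num.sqrt (w ^+ 2 + a)
    <= u / Num.sqrt (u ^+ 2 + a) + v / Num.sqrt (v ^+ 2 + a).
Proof.
move=> a0 a12 u0 v0 w0 hw.
have pos (b s : R) : 0 < b -> 0 < s ^+ 2 + b.
  by move=> b0; rewrite ltr_wpDl// sqr_ge0.
have rpos s : 0 < Num.sqrt (s ^+ 2 + a) by rewrite sqrtr_gt0 pos.
have sq (b s : R) : 0 < b -> Num.sqrt (s ^+ 2 + b) ^+ 2 = s ^+ 2 + b.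
  by move=> b0; rewrite sqr_sqrtr// ltW// pos.
have D2 := sq a u a0; have E2 := sq a v a0; have F2 := sq a w a0.
have G2 : Num.sqrt (u ^+ 2 + 4) ^+ 2 = u ^+ 2 + 4 by rewrite sq.
have H2 : Num.sqrt (v ^+ 2 + 4) ^+ 2 = v ^+ 2 + 4 by rewrite sq.
have D0 := rpos u; have E0 := rpos v; have F0 := rpos w.
have G0 := sqrtr_ge0 (u ^+ 2 + 4); have H0 := sqrtr_ge0 (v ^+ 2 + 4).
move: D2 E2 F2 G2 H2 D0 E0 F0 G0 H0 hw.
set D := Num.sqrt (u ^+ 2 + a); set E := Num.sqrt (v ^+ 2 + a).
set F := Num.sqrt (w ^+ 2 + a); set G := Num.sqrt (u ^+ 2 + 4).
set H := Num.sqrt (v ^+ 2 + 4).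
move: D E F G H => D E F G H D2 E2 F2 G2 H2 D0 E0 F0 G0 H0 hw {pos rpos sq}.
(* Normalized by [D] and [E], the squares of [g] and [h] (from [2 cosh s], [2 cosh t]) become
   polynomials in [P], [Q] up to the factor [a]. *)
pose P := u / D; pose Q := v / E; pose g := G / D; pose h := H / E.
rewrite -/P -/Q.
have P0 : 0 <= P by rewrite divr_ge0// ltW.
have Q0 : 0 <= Q by rewrite divr_ge0// ltW.
(* The left side is at most [1], so only [P + Q < 1] needs work. *)
have [PQ1|PQ1] := leP 1 (P + Q).
  apply: le_trans PQ1; rewrite ler_pdivrMr// mul1r.
  by rewrite -(@ler_pXn2r _ 2) ?nnegrE// ?(ltW F0)// F2 lerDl ltW.
have aP : a / D ^+ 2 = 1 - P ^+ 2.
  by rewrite /P expr_div_n D2; field; rewrite -D2 expf_neq0// gt_eqF.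
have aQ : a / E ^+ 2 = 1 - Q ^+ 2.
  by rewrite /Q expr_div_n E2; field; rewrite -E2 expf_neq0// gt_eqF.
have ag : a * g ^+ 2 = a * P ^+ 2 + 4 * (1 - P ^+ 2).
  by rewrite -aP /g /P !expr_div_n G2; ring.
have ah : a * h ^+ 2 = a * Q ^+ 2 + 4 * (1 - Q ^+ 2).
  by rewrite -aQ /h /Q !expr_div_n H2; ring.
pose W := w / (D * E).
have W0 : 0 <= W by rewrite divr_ge0// mulr_ge0// ltW.
have hW : 2 * W <= P * h + Q * g.
  have -> : P * h + Q * g = (u * H + v * G) / (D * E).
    by rewrite /P /h /Q /g; field; rewrite !gt_eqF.
  by rewrite /W mulrA ler_pM2r// invr_gt0 mulr_gt0.
have hW2 : 4 * W ^+ 2 <= (P * h + Q * g) ^+ 2.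
  have -> : 4 * W ^+ 2 = (2 * W) ^+ 2 by ring.
  have g0 : 0 <= g by rewrite divr_ge0// ltW.
  have h0 : 0 <= h by rewrite divr_ge0// ltW.
  apply: lerXn2r => //; rewrite nnegrE; first exact: mulr_ge0.
  by apply: addr_ge0; apply: mulr_ge0.
have PQ0 : 0 <= P * Q by rewrite mulr_ge0.
(* AM-GM removes the product [g * h], the only term still containing square roots. *)
have amgm : P * Q * (2 * (g * h)) <= P * Q * (g ^+ 2 + h ^+ 2).
  by apply: ler_wpM2l => //; have := sqr_ge0 (g - h); rewrite sqrrB; lra.
(* In [P], [Q] the upper bound for [4 a W^2] is [(P + Q)^2 (4 + (a - 4) P Q)]; [a <= 12] turns
   [a - 4] into [8]. *)
have bound : a * W ^+ 2 <= (P + Q) ^+ 2 * (1 + 2 * (P * Q)).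
  have : a * (4 * W ^+ 2) <= a * (P ^+ 2 * h ^+ 2 + Q ^+ 2 * g ^+ 2 +
      P * Q * (g ^+ 2 + h ^+ 2)).
    apply: ler_wpM2l; first exact: ltW.
    apply: le_trans hW2 _; have -> : (P * h + Q * g) ^+ 2
      = P ^+ 2 * h ^+ 2 + Q ^+ 2 * g ^+ 2 + P * Q * (2 * (g * h)) by ring.
    by rewrite lerD2l.
  have -> : a * (P ^+ 2 * h ^+ 2 + Q ^+ 2 * g ^+ 2 + P * Q * (g ^+ 2 + h ^+ 2))
    = P ^+ 2 * (a * h ^+ 2) + Q ^+ 2 * (a * g ^+ 2)
      + P * Q * (a * g ^+ 2 + a * h ^+ 2) by ring.
  rewrite ag ah.
  have : 0 <= (12 - a) * (P * Q * (P + Q) ^+ 2).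
    by rewrite mulr_ge0 ?subr_ge0// mulr_ge0// sqr_ge0.
  lra.
have S1 : 0 < 1 - (P + Q) ^+ 2.
  by rewrite subr_gt0 expr_lt1// addr_ge0.
have wW : a ^+ 2 * W ^+ 2 = w ^+ 2 * ((1 - P ^+ 2) * (1 - Q ^+ 2)).
  by rewrite -aP -aQ /W; field; rewrite !gt_eqF.
have cmp : (1 + 2 * (P * Q)) * (1 - (P + Q) ^+ 2)
    <= (1 - P ^+ 2) * (1 - Q ^+ 2).
  have := mulr_ge0 PQ0 (sqr_ge0 (P + Q)); have := sqr_ge0 (P * Q); lra.
have N0 : 0 < (1 - P ^+ 2) * (1 - Q ^+ 2).
  by rewrite -aP -aQ mulr_gt0// divr_gt0// exprn_gt0.
(* This is the goal squared, with [w^2] collected. Multiplying by [(1 - P^2) (1 - Q^2)] turns [w^2]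
   into [a^2 W^2], so [bound] and [cmp] apply. *)
have key : w ^+ 2 * (1 - (P + Q) ^+ 2) <= a * (P + Q) ^+ 2.
  rewrite -(ler_pM2r N0).
  have -> : w ^+ 2 * (1 - (P + Q) ^+ 2) * ((1 - P ^+ 2) * (1 - Q ^+ 2))
    = a * (1 - (P + Q) ^+ 2) * (a * W ^+ 2) by rewrite mulrAC -wW; ring.
  apply: (@le_trans _ _ (a * (1 - (P + Q) ^+ 2)
    * ((P + Q) ^+ 2 * (1 + 2 * (P * Q))))).
    by apply: ler_wpM2l => //; rewrite mulr_ge0// ltW.
  have -> : a * (1 - (P + Q) ^+ 2) * ((P + Q) ^+ 2 * (1 + 2 * (P * Q)))
    = a * (P + Q) ^+ 2 * ((1 + 2 * (P * Q)) * (1 - (P + Q) ^+ 2)) by ring.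
  by apply: ler_wpM2l => //; rewrite mulr_ge0 ?sqr_ge0// ltW.
rewrite ler_pdivrMr// -(@ler_pXn2r _ 2) ?nnegrE ?mulr_ge0 ?addr_ge0 ?(ltW F0)//.
rewrite exprMn F2; lra.
Qed.

(* With [u = 2 sinh s] and [r = 2 cosh s], [u * r] is [2 sinh (2 s)]. *)
Lemma sinh_quotient_double (R : realType) (a u r : R) :
  0 < a -> 0 < u -> 0 < r -> r ^+ 2 = u ^+ 2 + 4 ->
  u * r / Num.sqrt ((u * r) ^+ 2 + a)
    <= u / Num.sqrt (u ^+ 2 + a) + u / Num.sqrt (u ^+ 2 + a) ->
  a <= 12 + 3 * u ^+ 2.
Proof.
move=> a0 u0 r0 r2.
have pos s : 0 < s ^+ 2 + a by rewrite ltr_wpDl// sqr_ge0.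
have D0 : 0 < Num.sqrt (u ^+ 2 + a) by rewrite sqrtr_gt0.
have F0 : 0 < Num.sqrt ((u * r) ^+ 2 + a) by rewrite sqrtr_gt0.
rewrite -mulrDl -mulr2n ler_pdivrMr// mulrAC ler_pdivlMr//.
rewrite -(@ler_pXn2r _ 2) ?nnegrE ?mulr_ge0 ?sqrtr_ge0 ?mulrn_wge0
  ?(ltW u0) ?(ltW r0)//.
rewrite !exprMn !sqr_sqrtr ?(ltW (pos _))//; last by rewrite -exprMn ltW.
rewrite r2 => le_sq.
(* In the squared inequality the terms [4 a u^2] cancel, leaving a multiple of [u^4]. *)
have : 0 <= (12 + 3 * u ^+ 2 - a) * (u ^+ 2 * u ^+ 2) by lra.
by rewrite pmulr_lge0 ?subr_ge0// mulr_gt0// exprn_gt0.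
Qed.

(** * The function in terms of the scaled distance *)

Section PointPair.
Variables (R : realType) (n : nat).
Implicit Types (x y z : 'rV[R]_n) (a : R).

Definition scaled_dist x y : R :=
  enorm (x - y) / Num.sqrt (enorm x * enorm y).

Lemma scaled_dist_ge0 x y : 0 <= scaled_dist x y.
Proof. by rewrite divr_ge0 ?sqrtr_ge0 ?enorm_ge0. Qed.

(** Serves twice: general [a] gives the denominator of [point_pair], [a = 4] gives [2 cosh s]. *)
Lemma sqrt_scaled_dist a x y : x != 0 -> y != 0 ->
  Num.sqrt (scaled_dist x y ^+ 2 + a)
    = Num.sqrt (enorm (x - y) ^+ 2 + a * (enorm x * enorm y))
      / Num.sqrt (enorm x * enorm y).
Proof.
rewrite -!enorm_gt0 => x0 y0.
have XY : 0 < enorm x * enorm y by rewrite mulr_gt0.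
apply/(canRL (mulfK _)); first by rewrite gt_eqF// sqrtr_gt0.
rewrite [LHS]mulrC -sqrtrM ?(ltW XY)// expr_div_n (sqr_sqrtr (ltW XY)).
by congr Num.sqrt; field; rewrite !gt_eqF.
Qed.

Lemma point_pairE a x y : x != 0 -> y != 0 ->
  point_pair a x y
    = scaled_dist x y / Num.sqrt (scaled_dist x y ^+ 2 + a).
Proof.
move=> x0 y0; rewrite sqrt_scaled_dist// /point_pair /scaled_dist -mulrA.
have XY : Num.sqrt (enorm x * enorm y) != 0.
  by rewrite gt_eqF// sqrtr_gt0 mulr_gt0// enorm_gt0.
by rewrite mulrA invf_div mulrA mulfVK.
Qed.

Lemma scaled_dist_ptolemy x y z : x != 0 -> y != 0 -> z != 0 ->
  2 * scaled_dist x z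
    <= scaled_dist x y * Num.sqrt (scaled_dist y z ^+ 2 + 4)
       + scaled_dist y z * Num.sqrt (scaled_dist x y ^+ 2 + 4).
Proof.
move=> x0 y0 z0; rewrite !sqrt_scaled_dist// /scaled_dist.
move: x0 y0 z0; rewrite -!enorm_gt0 => x0 y0 z0.
(* The points [x], [z], [-y], [y] translated by [-y], which puts [y] at the origin. *)
have := ptolemy (x - y) (z - y) (- (2 *: y)).
rewrite enormN enormZ ger0_norm// opprB addrA subrK !opprK.
have shift t : t - y + 2 *: y = t + y by apply/rowP => i; rewrite !mxE; ring.
rewrite !shift [in leRHS](enormBC z y) => pt.
have := le_trans pt (lerD
  (ler_wpM2l (enorm_ge0 (x - y)) (enorm_add_le z y))
  (ler_wpM2l (enorm_ge0 (y - z)) (enorm_add_le x y))).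
rewrite (enormBC z y) (mulrC (enorm z)) => {}pt.
rewrite !sqrtrM ?enorm_ge0//.
have := x0; have := y0; have := z0; rewrite -![0 < enorm _]sqrtr_gt0.
move: pt; rewrite -{1}(sqr_sqrtr (enorm_ge0 y)).
set p := Num.sqrt (enorm x); set q := Num.sqrt (enorm y).
set r := Num.sqrt (enorm z); move=> pt r0 q0 p0.
have pqr : 0 < (q ^+ 2 * p * r)^-1 by rewrite invr_gt0 !mulr_gt0// exprn_gt0.
move: pt; rewrite -(ler_pM2r pqr); congr (_ <= _);
  by field; rewrite !gt_eqF.
Qed.

(** Square factors make the root rational. The value is [2 sinh |log b - log c|], so [s] is additive
    along a ray. *)
Lemma scaled_dist_collinear (e : 'rV[R]_n) (b c : R) :
  e != 0 -> 0 < b -> 0 < c ->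
  scaled_dist (b ^+ 2 *: e) (c ^+ 2 *: e) = `|b ^+ 2 - c ^+ 2| / (b * c).
Proof.
rewrite -enorm_gt0 => e0 b0 c0.
rewrite /scaled_dist -scalerBl !enormZ !(ger0_norm (sqr_ge0 _)).
have -> : b ^+ 2 * enorm e * (c ^+ 2 * enorm e) = (b * c * enorm e) ^+ 2
  by ring.
rewrite sqrtr_sqr [`|b * c * _|]ger0_norm; first by field; rewrite !gt_eqF.
by rewrite ltW// !mulr_gt0.
Qed.

End PointPair.

(** * The counterexample for [alpha > 12] and the metric axioms for [alpha <= 12] *)

Theorem theorem5p11 (R : realType) (alpha : R) (n : nat)
    (halpha : 0 < alpha) (hn : (2 <= n)%N) :
  is_metric_on (@punctured_space R n) (@point_pair R n alpha)
  <-> alpha <= 12.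
Proof.
split=> [|alpha12].
  move=> dm; rewrite leNgt; apply/negP => alpha12.
  pose e : 'rV[R]_n := const_mx 1.
  have e0 : e != 0.
    apply/eqP => /rowP /(_ (Ordinal (ltnW hn))); rewrite !mxE.
    by move/eqP; rewrite oner_eq0.
  (* Below, [u <= 2 eps], so [3 u^2 <= 12 eps^2 <= 12 eps <= (alpha - 12) / 2], which contradicts
     [alpha <= 12 + 3 u^2]. *)
  pose eps : R := Num.min 1 ((alpha - 12) / 24).
  have eps0 : 0 < eps by rewrite lt_min ltr01 divr_gt0// subr_gt0.
  have eps1 : eps <= 1 by rewrite ge_min lexx.
  have epsa : eps <= (alpha - 12) / 24 by rewrite ge_min lexx orbT.
  move: eps eps0 eps1 epsa => eps eps0 eps1 epsa.
  pose q := 1 + eps.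
  have q0 : 0 < q by rewrite addr_gt0.
  have q1 : 0 < q ^+ 2 - 1 by rewrite /q; have := exprn_gt0 2 eps0; lra.
  have ne0 c : 0 < c -> c ^+ 2 *: e != 0.
    by move=> c0; rewrite scaler_eq0 negb_or e0 andbT gt_eqF// exprn_gt0.
  have q20 : 0 < q ^+ 2 by rewrite exprn_gt0.
  have := metric_on_triangle dm (ne0 1 ltr01) (ne0 q q0) (ne0 (q ^+ 2) q20).
  rewrite !point_pairE ?ne0// !scaled_dist_collinear//.
  have -> : `|1 ^+ 2 - q ^+ 2| / (1 * q) = (q ^+ 2 - 1) / q.
    by rewrite distrC ger0_norm expr1n ?mul1r// ltW.
  have -> : `|q ^+ 2 - (q ^+ 2) ^+ 2| / (q * q ^+ 2) = (q ^+ 2 - 1) / q.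
    have -> : q ^+ 2 - (q ^+ 2) ^+ 2 = - (q ^+ 2 * (q ^+ 2 - 1)) by ring.
    rewrite normrN ger0_norm; first by field; rewrite gt_eqF.
    by rewrite mulr_ge0 ?ltW.
  have -> : `|1 ^+ 2 - (q ^+ 2) ^+ 2| / (1 * q ^+ 2)
      = (q ^+ 2 - 1) / q * ((q ^+ 2 + 1) / q).
    have -> : 1 ^+ 2 - (q ^+ 2) ^+ 2 = - ((q ^+ 2 - 1) * (q ^+ 2 + 1)) by ring.
    rewrite normrN ger0_norm; first by field; rewrite gt_eqF.
    by rewrite mulr_ge0 ?ltW// addr_gt0.
  (* [u] and [r] are [2 sinh s] and [2 cosh s] for [s = log q]. *)
  set u := (q ^+ 2 - 1) / q; set r := (q ^+ 2 + 1) / q.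
  have u0 : 0 < u by rewrite divr_gt0.
  have r0 : 0 < r by rewrite divr_gt0// addr_gt0.
  have r2 : r ^+ 2 = u ^+ 2 + 4 by rewrite /r /u; field; rewrite gt_eqF.
  move=> /(sinh_quotient_double halpha u0 r0 r2).
  have u2eps : u <= 2 * eps.
    by rewrite ler_pdivrMr// /q; have := sqr_ge0 eps; lra.
  have : u ^+ 2 <= (2 * eps) ^+ 2.
    by apply: lerXn2r u2eps; rewrite nnegrE ltW// mulr_gt0.
  have : eps * eps <= eps * 1 by rewrite ler_pM2l.
  lra.
have sqrt_pos (x y : 'rV[R]_n) : x != 0 -> y != 0 ->
    0 < Num.sqrt (enorm (x - y) ^+ 2 + alpha * enorm x * enorm y).
  move=> x0 y0; rewrite sqrtr_gt0 ltr_wpDl ?sqr_ge0//.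
  by rewrite !mulr_gt0 ?enorm_gt0.
split=> [x y x0 y0|x y x0 y0|x y x0 y0|x y z x0 y0 z0].
- by rewrite divr_ge0 ?sqrtr_ge0 ?enorm_ge0.
- split=> [/eqP|->].
    rewrite mulf_eq0 invr_eq0 (gt_eqF (sqrt_pos _ _ x0 y0)) orbF enorm_eq0.
    by rewrite subr_eq0 => /eqP.
  by rewrite /point_pair subrr (eqP (_ : enorm 0 == 0)) ?enorm_eq0// mul0r.
- by rewrite /point_pair enormBC mulrAC.
- rewrite !point_pairE//; apply: sinh_quotient_subadditive => //;
    by [exact: scaled_dist_ge0|exact: scaled_dist_ptolemy].
Qed.
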